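(* Let $\mathcal{A}$ be a family of functions, each $g\in\mathcal{A}$ being a function $g:\mathbf{No}^{n_g+1}\to\mathbf{No}$ for some $n_g\ge 0$, such that every $g\in\mathcal{A}$ is tame and satisfies the $\sup$ property. Let $f:\mathbf{No}\to\mathbf{No}$ be uniformly recursive over $\mathcal{A}$, and suppose that $f$ is tame. Then $f$ satisfies the $\sup$ property.
   Context: Surreal numbers: $\mathbf{No}$ is the class of all functions $x:\alpha\to\{+,-\}$ with $\alpha$ an ordinal (the sign sequence of $x$). For $x\neq y$ let $\gamma$ be the least ordinal where $x(\gamma)\neq y(\gamma)$ (one of them possibly undefined); then $x<y$ iff $(x(\gamma),y(\gamma))$ is $(-,\text{undefined})$, $(-,+)$ or $(\text{undefined},+)$. $y\prec x$ ($y$ strictly simpler than $x$) iff $y$ is the restriction of $x$ to an ordinal strictly smaller than the length of $x$; $y\preceq x$ iff $y\prec x$ or $y=x$. Every nonempty convex subclass of $\mathbf{No}$ has a unique $\preceq$-least (simplest) element. For sets $L<R$ of surreals, $\{L\mid R\}$ is the simplest $x$ with $L<x<R$. For $x\in\mathbf{No}$ put $L^x=\{y<x: y\prec x\}$, $R^x=\{y>x: y\prec x\}$; then $x=\{L^x\mid R^x\}$. A representation of $x$ is any pair of sets $X^L<X^R$ with $x=\{X^L\mid X^R\}$. Recursive definitions: let $f:\mathbf{No}\to\mathbf{No}$ and let $L,R$ be sets of functions (left and right options), each option $g$ being a function $g(x,y,z,u,v)$ of five surreal arguments (possibly not depending on some of them). One writes $f=\{L\mid R\}$ if for every $x\in\mathbf{No}$,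 $f(x)=\{\,g(x,x^L,x^R,f(x^L),f(x^R)) : g\in L\ \mid\ g(x,x^L,x^R,f(x^L),f(x^R)): g\in R\,\}$, where $x^L$ ranges over $L^x$ and $x^R$ over $R^x$ (for an option not depending on its second/fourth (resp. third/fifth) arguments, the quantification over $x^L$ (resp. $x^R$) is omitted). The definition is uniform if (i) for all $y<x<z$ in $\mathbf{No}$, $g(x,y,z,f(y),f(z))<f(x)$ for every $g\in L$ and $g(x,y,z,f(y),f(z))>f(x)$ for every $g\in R$, and (ii) the displayed identity still holds when $L^x,R^x$ are replaced by $X^L,X^R$ for any representation $x=\{X^L\mid X^R\}$. $f$ is (uniformly) recursive over a family $\mathcal{A}$ if it has a (uniform) recursive definition $f=\{L\mid R\}$ with $L,R\subseteq\mathcal{A}$. Properties below of a function of several variables refer to the first variable, the remaining ones being parameters. Dedekind completion: an element of the Dedekind completion of $\mathbf{No}$ not in $\mathbf{No}$ is a gap, i.e. a partition $(A,B)$ of $\mathbf{No}$ into nonempty classes with $A<B$, $A$ without maximum and $B$ without minimum; for $a\in\mathbf{No}$, $a<\zeta$ means $a\in A$, and $(a,\zeta)=\{x\in A: x>a\}$, etc. Tame: $h:\mathbf{No}^{n+1}\to\mathbf{No}$ is tame iff for every $\vec d\in\mathbf{No}^n$, either $x\mapsto h(x,\vec d)$ is constant, or for every gap $\zeta$ and every $c\in\mathbf{No}$ there exist $a,b\in\mathbf{No}$ with $a<\zeta<b$ such that either $h(x,\vec d)>c$ for all $x\in(a,\zeta)$ or $h(x,\vec d)<c$ for all $x\in(a,\zeta)$,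 and likewise either $h(x,\vec d)>c$ for all $x\in(\zeta,b)$ or $h(x,\vec d)<c$ for all $x\in(\zeta,b)$. $\sup$ property: $h:\mathbf{No}^{n+1}\to\mathbf{No}$ satisfies it iff for all $\vec d\in\mathbf{No}^n$, all $a<b$ and $c$ in $\mathbf{No}$, the infima and suprema (taken in the Dedekind completion with $\pm\infty$) of the classes $\{x\in\mathbf{No}: a<x<b,\ h(x,\vec d)\le c\}$ and $\{x\in\mathbf{No}: a<x<b,\ h(x,\vec d)\ge c\}$ belong to $\mathbf{No}\cup\{\pm\infty\}$ (i.e. are not gaps). *)

(* Defs.v *)
From mathcomp Require Import all_boot.
From mathcomp Require Import boolp classical_sets.

Set Implicit Arguments.
Unset Strict Implicit.
Unset Printing Implicit Defensive.

Local Open Scope classical_set_scope.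

(** * Sets and classes

    The universe [Set] plays the role of the universe of sets.  Classes are
    predicates ([set T]) on arbitrary, possibly large, types; a class is a set
    when it is the image of a family indexed by a type in [Set]. *)

Definition small (T : Type) (S : set T) : Prop :=
  exists (J : Set) (h : J -> T), S = range h.

(** * Ordinals

    Ordinals are the ranks of the well-founded trees with small branching:
    [tle s t] means rank s <= rank t, [tlt s t] means rank s < rank t, and an
    ordinal is the class of all trees of a given rank.  The lemmas [olt_wf],
    [olt_trans], [olt_total], [olt_small] and [small_bounded] below (a
    well-ordered class whose proper initial segments are sets and whose subsets
    that are sets are bounded) characterize the class of all ordinals up to
    isomorphism. *)

Inductive tree : Type := node (J : Set) (h : J -> tree).

Fixpoint tle (s t : tree) : Prop :=
  match s, t with
  | node J h, node K k => forall i : J, exists j : K, tle (h i) (k j)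
  end.

Definition tlt (s t : tree) : Prop :=
  match t with node K k => exists j : K, tle s (k j) end.

Definition rank_class (t : tree) : set tree :=
  [set s | tle s t /\ tle t s].

Record On : Type := MkOn {
  ord_class : set tree;
  ord_classP : exists t, ord_class = rank_class t }.

Definition olt (a b : On) : Prop :=
  exists s t, [/\ ord_class a s, ord_class b t & tlt s t].

Definition ord_of (t : tree) : On :=
  @MkOn (rank_class t) (ex_intro _ t erefl).

Lemma tle_refl t : tle t t.
Proof. by elim: t => J h IH /= i; exists i. Qed.

Lemma tle_trans s t u : tle s t -> tle t u -> tle s u.
Proof.
elim: s t u => J h IH [K k] [M l] /= st tu i.
have [j ij] := st i; have [m jm] := tu j.
by exists m; apply: IH ij jm.
Qed.

Lemma tlt_or_tle s t : tlt t s \/ tle s t.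
Proof.
elim: s t => J h IH [K k].
have [[i iP]|H] := pselect (exists i, tle (node k) (h i)).
  by left; exists i.
right => /= i; apply: contrapT => Hi; apply: H; exists i.
case hi : (h i) => [M l] /= j.
have [|ij] := IH i (k j); first by rewrite hi.
by case: Hi; exists j.
Qed.

Lemma tle_lt_trans s t u : tle s t -> tlt t u -> tlt s u.
Proof. by case: u => M l st [m tm]; exists m; apply: tle_trans st tm. Qed.

Lemma tlt_le_trans s t u : tlt s t -> tle t u -> tlt s u.
Proof.
case: t u => K k [M l] [j sj] tu.
by have [m jm] := tu j; exists m; apply: tle_trans sj jm.
Qed.

Lemma tltW s t : tlt s t -> tle s t.
Proof.
elim: t s => K k IH [J h] [j sj] /= i; exists j; apply: IH.
by move: sj; case: (k j) => M l; apply.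
Qed.

Lemma tlt_wf : well_founded tlt.
Proof.
suff H t s : tle s t -> Acc tlt s by move=> t; apply: (H t); apply: tle_refl.
elim: t s => K k IH s st; constructor => r rs.
have [j rj] := tlt_le_trans rs st.
exact: IH rj.
Qed.

Lemma ord_ofP (a : On) : exists t, a = ord_of t.
Proof.
case: a => C p; have [t Ct] := p; exists t; subst C.
by rewrite /ord_of; congr MkOn; apply: Prop_irrelevance.
Qed.

Lemma olt_ord_of s t : olt (ord_of s) (ord_of t) <-> tlt s t.
Proof.
split=> [[s' [t' [[_ ss'] [tt' _] st]]]|st].
  exact: tlt_le_trans (tle_lt_trans ss' st) tt'.
by exists s, t; split=> //; split; apply: tle_refl.
Qed.

Lemma ord_of_eq s t : tle s t -> tle t s -> ord_of s = ord_of t.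
Proof.
move=> st ts.
have E : rank_class s = rank_class t.
  apply/seteqP; split=> r [rs sr]; split.
  - exact: tle_trans rs st.
  - exact: tle_trans ts sr.
  - exact: tle_trans rs ts.
  - exact: tle_trans st sr.
rewrite /ord_of; move: (ex_intro _ s _) (ex_intro _ t _); rewrite E => p q.
by congr MkOn; apply: Prop_irrelevance.
Qed.

Lemma olt_wf : well_founded olt.
Proof.
move=> a; have [t ->] := ord_ofP a.
elim: (tlt_wf t) => {}t _ IH; constructor => b.
by have [s ->] := ord_ofP b => /olt_ord_of; apply: IH.
Qed.

Lemma olt_trans (a b c : On) : olt a b -> olt b c -> olt a c.
Proof.
have [s ->] := ord_ofP a; have [t ->] := ord_ofP b; have [u ->] := ord_ofP c.
move=> /olt_ord_of st /olt_ord_of tu; apply/olt_ord_of.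
exact: tle_lt_trans (tltW st) tu.
Qed.

Lemma olt_total (a b : On) : [\/ olt a b, a = b | olt b a].
Proof.
have [s ->] := ord_ofP a; have [t ->] := ord_ofP b.
have [ts|st] := tlt_or_tle s t; first by apply/Or33/olt_ord_of.
have [st'|ts] := tlt_or_tle t s; first by apply/Or31/olt_ord_of.
by apply: Or32; apply: ord_of_eq.
Qed.

Fixpoint subtree_index (t : tree) : Set :=
  match t with node J h => {i : J & option (subtree_index (h i))} end.

Fixpoint subtree (t : tree) : subtree_index t -> tree :=
  match t with
  | node J h => fun p => match p with
    | existT i None => h i
    | existT i (Some q) => subtree q
    end
  end.

Lemma olt_small (b : On) : small [set a | olt a b].
Proof.
have [t ->] := ord_ofP b.
exists (subtree_index t), (fun p => ord_of (subtree p)).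
apply/seteqP; split=> [a|_ [p _ <-]].
  have [s ->] := ord_ofP a => /olt_ord_of.
  elim: t => J h IH [i si].
  have [/IH[q _ qs]|his] := tlt_or_tle (h i) s.
    by exists (existT _ i (Some q)).
  by exists (existT _ i None) => //; apply: ord_of_eq.
apply/olt_ord_of; elim: t p => J h IH [i [q|]] /=; exists i.
  exact/tltW/IH.
exact: tle_refl.
Qed.

Lemma small_bounded (S : set On) :
  small S -> exists b, forall a, S a -> olt a b.
Proof.
move=> [J [h ->]].
pose r a := projT1 (cid (ord_ofP a)).
exists (ord_of (node (fun i => r (h i)))) => _ [i _ <-].
rewrite {1}(projT2 (cid (ord_ofP (h i)))) -/(r _); apply/olt_ord_of.
by exists i; apply: tle_refl.
Qed.

(** * Surreal numbers *)

Inductive sign := Minus | Plus.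

(** A sign sequence of length [a] is encoded as a partial function on [On],
    undefined ([None]) exactly outside of [{b | b < a}]. *)
Record No : Type := MkNo {
  len : On;
  sgn :> On -> option sign;
  sgn_dom : forall b, sgn b <> None <-> olt b len }.

Definition slt (x y : No) : Prop :=
  exists2 c : On, (forall b, olt b c -> x b = y b) &
    [\/ x c = Some Minus /\ y c = None,
        x c = Some Minus /\ y c = Some Plus
      | x c = None /\ y c = Some Plus].

Definition sle (x y : No) : Prop := slt x y \/ x = y.

Definition simpler (y x : No) : Prop :=
  olt (len y) (len x) /\ (forall b, olt b (len y) -> y b = x b).

Definition simpler_eq (y x : No) : Prop := simpler y x \/ y = x.

Definition simplest (C : set No) (x : No) : Prop :=
  C x /\ (forall y, C y -> simpler_eq x y).

Definition set_lt (L R : set No) : Prop :=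
  forall l r, L l -> R r -> slt l r.

(** [is_cut L R x] is [x = {L | R}], where the right-hand side is only defined
    for sets [L < R]; that is, [(L, R)] is a representation of [x]. *)
Definition is_cut (L R : set No) (x : No) : Prop :=
  [/\ small L, small R, set_lt L R &
      simplest [set y | (forall l, L l -> slt l y) /\
                        (forall r, R r -> slt y r)] x].

Definition Lopt (x : No) : set No := [set y | slt y x /\ simpler y x].
Definition Ropt (x : No) : set No := [set y | slt x y /\ simpler y x].

(** * Recursive definitions

    Options are functions [g(x, y, z, u, v)], to be evaluated at
    [y = x^L], [z = x^R], [u = f(x^L)], [v = f(x^R)]. *)

Definition option5 : Type := No -> No -> No -> No -> No -> No.

Definition indep_left (g : option5) : Prop :=
  (forall x y y' z u v, g x y z u v = g x y' z u v) /\
  (forall x y z u u' v, g x y z u v = g x y z u' v).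

Definition indep_right (g : option5) : Prop :=
  (forall x y z z' u v, g x y z u v = g x y z' u v) /\
  (forall x y z u v v', g x y z u v = g x y z u v').

(** The values at [x] of the options in [G], for the representation
    [(XL, XR)].  When [g] does not depend on its second and fourth arguments,
    the quantification over [XL] is omitted: [y] is then a dummy, on which the
    value does not depend, and which is available even when [XL] is empty.
    Likewise for [XR]. *)
Definition option_values (G : set option5) (f : No -> No) (x : No)
    (XL XR : set No) : set No :=
  [set w | exists g y z, [/\ G g, XL y \/ indep_left g, XR z \/ indep_right g
                           & w = g x y z (f y) (f z)]].

Definition recursive_def (f : No -> No) (L R : set option5) : Prop :=
  [/\ small L, small R &
      forall x, is_cut (option_values L f x (Lopt x) (Ropt x))
                       (option_values R f x (Lopt x) (Ropt x)) (f x)].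

Definition uniform_def (f : No -> No) (L R : set option5) : Prop :=
  [/\ recursive_def f L R,
      forall x y z, slt y x -> slt x z ->
        (forall g, L g -> slt (g x y z (f y) (f z)) (f x)) /\
        (forall g, R g -> slt (f x) (g x y z (f y) (f z)))
    & forall x XL XR, is_cut XL XR x ->
        is_cut (option_values L f x XL XR) (option_values R f x XL XR) (f x)].

(** A family of functions of [n + 1] variables, [n] arbitrary. *)
Definition function_family : Type := forall n : nat, set (n.+1.-tuple No -> No).

(** [g] is a member of [A] seen as a function of the five variables
    [x, y, z, u, v]: its own variables are distinct ones among these five
    (variable [i] being number [s i]), and [x], if it is used, is its first
    variable. *)
Definition option_of (A : function_family) (g : option5) : Prop :=
  exists (n : nat) (h : n.+1.-tuple No -> No) (s : 'I_n.+1 -> 'I_5),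
    [/\ A n h, injective s, forall i, s i = ord0 -> i = ord0 &
        forall x y z u v,
          g x y z u v = h [tuple tnth [tuple x; y; z; u; v] (s i) | i < n.+1]].

Definition uniformly_recursive_over (A : function_family) (f : No -> No) : Prop :=
  exists L R : set option5,
    [/\ L `<=` option_of A, R `<=` option_of A & uniform_def f L R].

(** * The Dedekind completion *)

Record gap : Type := MkGap {
  lower : set No;
  upper : set No;
  gap_cover : lower `|` upper = setT;
  gap_disj : lower `&` upper = set0;
  gap_lower_neq0 : lower !=set0;
  gap_upper_neq0 : upper !=set0;
  gap_lt : forall a b, lower a -> upper b -> slt a b;
  gap_nomax : forall a, lower a -> exists2 a', lower a' & slt a a';
  gap_nomin : forall b, upper b -> exists2 b', upper b' & slt b' b }.

Inductive completion : Type :=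
  | MInfty | PInfty | Point of No | Gap of gap.

Definition cle (p q : completion) : Prop :=
  match p, q with
  | MInfty, _ => True
  | _, PInfty => True
  | Point x, Point y => sle x y
  | Point x, Gap k => lower k x
  | Gap k, Point y => upper k y
  | Gap k, Gap k' => lower k `<=` lower k'
  | _, _ => False
  end.

Definition is_inf (S : set No) (p : completion) : Prop :=
  (forall x, S x -> cle p (Point x)) /\
  (forall q, (forall x, S x -> cle q (Point x)) -> cle q p).

Definition is_sup (S : set No) (p : completion) : Prop :=
  (forall x, S x -> cle (Point x) p) /\
  (forall q, (forall x, S x -> cle (Point x) q) -> cle p q).

Definition is_gap (p : completion) : Prop := exists k, p = Gap k.

(** * Tame functions and the sup property

    Both are properties of the functions of the first variable obtained by
    fixing the other ones. *)

Definition tame1 (h : No -> No) : Prop :=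
  (exists e, forall x, h x = e) \/
  forall (k : gap) (c : No), exists a b, [/\ lower k a, upper k b,
    (forall x, slt a x -> lower k x -> slt c (h x)) \/
    (forall x, slt a x -> lower k x -> slt (h x) c) &
    (forall x, upper k x -> slt x b -> slt c (h x)) \/
    (forall x, upper k x -> slt x b -> slt (h x) c)].

Definition sup_property1 (h : No -> No) : Prop :=
  forall a b c : No, slt a b ->
    let le_c := [set x | [/\ slt a x, slt x b & sle (h x) c]] in
    let ge_c := [set x | [/\ slt a x, slt x b & sle c (h x)]] in
    [/\ exists2 p, is_inf le_c p & ~ is_gap p,
        exists2 p, is_sup le_c p & ~ is_gap p,
        exists2 p, is_inf ge_c p & ~ is_gap p
      & exists2 p, is_sup ge_c p & ~ is_gap p].

Definition tame (n : nat) (h : n.+1.-tuple No -> No) : Prop :=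
  forall d : n.-tuple No, tame1 (fun x => h [tuple of x :: d]).

Definition sup_property (n : nat) (h : n.+1.-tuple No -> No) : Prop :=
  forall d : n.-tuple No, sup_property1 (fun x => h [tuple of x :: d]).

(* Main.v *)
(** A tame function violating the sup property crosses some value [c] at some
    gap [k]: it is below [c] on one side of [k] and above [c] on the other.  Take
    [c] of minimal length among the values [f] crosses at [k], and let [x] be a
    long enough initial segment of the sign sequence of [k].  By minimality
    [f x] lies between the canonical options of [c]; were [c] in the cut that
    defines [f x], it would then equal [f x].  Hence an option value
    [g(x, y, z, f(y), f(z))] of [f x] is on the wrong side
    of [c]; here [y] and [z] are shorter initial segments of [k].  By Fodor's lemma
    the same [g], [y], [z] serve for unboundedly long [x], hence for [x]
    arbitrarily close to [k].  Since [g] bounds [f] on all of the interval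
    [(y, z)], the class of such [x] accumulates at [k] from one side only, and
    [k] is its supremum or infimum, against the sup property of [g]. *)

Require Import Defs.
From mathcomp Require Import all_boot.
From mathcomp Require Import boolp classical_sets.

Set Implicit Arguments.
Unset Strict Implicit.
Unset Printing Implicit Defensive.

Local Open Scope classical_set_scope.

(** * Closure properties of small classes *)

Lemma small_setT (J : Set) : small [set: J].
Proof. by exists J, id; apply/seteqP; split=> // x _; exists x. Qed.

Lemma small_set1 (T : Type) (x : T) : small [set x].
Proof.
exists unit, (fun=> x); apply/seteqP; split=> [_ ->|_ [] //].
by exists tt.
Qed.

Lemma small_sub (T : Type) (S S' : set T) :
  S `<=` S' -> small S' -> small S.
Proof.
move=> SS' [J [h hE]]; exists {j : J | S (h j)}, (fun j => h (sval j)).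
apply/seteqP; split=> [x Sx|_ [[j Sj] _ <-]] //.
have := SS' _ Sx; rewrite hE => -[j _ jx].
have Sj : S (h j) by rewrite jx.
by exists (exist _ j Sj).
Qed.

Lemma small_image (T U : Type) (F : T -> U) (S : set T) :
  small S -> small (F @` S).
Proof. by move=> [J [h ->]]; exists J, (F \o h); rewrite image_comp. Qed.

Lemma small_setU (T : Type) (S S' : set T) :
  small S -> small S' -> small (S `|` S').
Proof.
move=> [J [h ->]] [K [k ->]].
exists (J + K)%type, (fun i => match i with inl j => h j | inr j => k j end).
apply/seteqP; split=> [_ [] [j _ <-]|_ [[] j _ <-]].
- by exists (inl j).
- by exists (inr j).
- by left; exists j.
- by right; exists j.
Qed.

Lemma small_setX (T U : Type) (S : set T) (S' : set U) :
  small S -> small S' -> small (S `*` S').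
Proof.
move=> [J [h ->]] [K [k ->]].
exists (J * K)%type, (fun i => (h i.1, k i.2)).
apply/seteqP; split=> [[_ _] [/= [i _ <-] [j _ <-]]|_ [[i j] _ <-]].
  by exists (i, j).
by split; [exists i|exists j].
Qed.

(** * Ordinals and pressing down *)

Lemma olt_irr a : ~ olt a a.
Proof. by elim: (olt_wf a) => {}a _ IH aa; apply: (IH a). Qed.

Lemma ex_olt_minimal (P : set On) :
  P !=set0 -> exists2 m, P m & forall b, olt b m -> ~ P b.
Proof.
move=> [a]; elim: (olt_wf a) => {}a _ IH Pa.
have [[b [ba Pb]]|H] := pselect (exists b, olt b a /\ P b).
  exact: IH ba Pb.
by exists a => // b ba Pb; apply: H; exists b.
Qed.

Lemma olt_not_sym a b : ~ olt a b -> a = b \/ olt b a.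
Proof. by have [||] := olt_total a b; [|left|right]. Qed.

Lemma olt_bound2 a b : exists2 c, olt a c & olt b c.
Proof.
have [c cP] := small_bounded (small_setU (small_set1 a) (small_set1 b)).
by exists c; apply: cP; [left|right].
Qed.

Lemma olt_nat_sup (d : nat -> On) : exists2 a,
  forall n, olt (d n) a & forall b, olt b a -> exists n, ~ olt (d n) b.
Proof.
have [|a Pa aP] := @ex_olt_minimal [set a | forall n, olt (d n) a].
  have [a aP] := small_bounded (small_image d (small_setT nat)).
  by exists a => n; apply: aP; exists n.
by exists a => // b /aP/existsNP.
Qed.

(** Fodor's lemma for the class of all ordinals; [K a] plays the role of the set
    of ordinals below [a]. *)
Lemma pressing_down (T : Type) (K C : On -> set T) (a0 : On) :
  (forall a, small (K a)) ->
  (forall (d : nat -> On) a t, (forall n, olt (d n) (d n.+1)) ->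
     (forall b, olt b a -> exists n, olt b (d n)) ->
     K a t -> exists n, K (d n) t) ->
  (forall a, olt a0 a -> exists2 t, K a t & C a t) ->
  exists t, forall a, exists2 b, olt a b & C b t.
Proof.
move=> Ksmall Kcont KC; apply: contrapT => /forallNP noT.
have {noT} [B BP] : {B : T -> On & forall t b, olt (B t) b -> ~ C b t}.
  apply: (@choice _ _ (fun t a => forall b, olt a b -> ~ C b t)) => t.
  have /existsNP[a aP] := noT t.
  by exists a => b ab Cb; apply: aP; exists b.
(* From [h a] on, no element of [K a] belongs to [C] any more. *)
have [h hP] : {h : On -> On & forall a, olt a (h a) /\
    forall t, K a t -> olt (B t) (h a)}.
  apply: (@choice _ _ (fun a b => olt a b /\ forall t, K a t -> olt (B t) b)) => a.
  have [b bP] := small_bounded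
    (small_setU (small_set1 a) (small_image B (Ksmall a))).
  by exists b; split=> [|t Kt]; apply: bP; [left|right; exists t].
pose d n := iter n h a0.
have dS n : olt (d n) (d n.+1) by case: (hP (d n)).
(* At the supremum [a] of the iterates of [h], the chosen [t] in [K a] already lies in some
   [K (d n)], hence has left [C] by stage [d n.+1], which is below [a]. *)
have [a ad da] := olt_nat_sup d.
have [t Kt Ct] := KC a (ad 0).
have [|n Kn] := Kcont d a t dS _ Kt.
  move=> b /da[n /olt_not_sym[dnb|bn]]; last by exists n.
  by exists n.+1; rewrite -dnb.
apply: BP Ct; apply: olt_trans (ad n.+1).
exact: (hP _).2.
Qed.

(** * The linear order of the surreal numbers *)

(** Encodes minus < undefined < plus by numbers, so that the three cases of [slt] become one
    inequality. *)
Definition sign_rank (o : option sign) : nat :=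
  match o with Some Minus => 0 | None => 1 | Some Plus => 2 end.

Lemma sign_rank_inj : injective sign_rank.
Proof. by move=> [[]|] [[]|]. Qed.

Lemma sltP x y : slt x y <-> exists2 c : On,
  forall b, olt b c -> x b = y b & sign_rank (x c) < sign_rank (y c).
Proof.
split=> [[c xy H]|[c xy H]]; exists c => //.
  by case: H => -[-> ->].
move: H; case: (x c) => [[]|]; case: (y c) => [[]|] // _.
- by apply: Or32.
- by apply: Or31.
- by apply: Or33.
Qed.

Lemma slt_irr x : ~ slt x x.
Proof. by move=> /sltP[c _]; rewrite ltnn. Qed.

Lemma slt_trans x y z : slt x y -> slt y z -> slt x z.
Proof.
move=> /sltP[c xy xyc] /sltP[e yz yze]; apply/sltP.
have [ce|ce|ec] := olt_total c e.
- exists c => [b bc|]; last by rewrite -yz.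
  by rewrite xy ?yz //; apply: olt_trans ce.
- subst e; exists c => [b bc|]; first by rewrite xy ?yz.
  exact: ltn_trans yze.
- exists e => [b be|]; last by rewrite xy.
  by rewrite xy ?yz //; apply: olt_trans ec.
Qed.

Lemma slt_not_sym x y : slt x y -> ~ slt y x.
Proof. by move=> xy yx; apply: slt_irr (slt_trans xy yx). Qed.

Lemma No_eq (x y : No) : (forall b, x b = y b) -> x = y.
Proof.
move=> xy; have E : len x = len y.
  have [xly||ylx] := olt_total (len x) (len y) => //.
    by case: (@olt_irr (len x)); apply/sgn_dom; rewrite xy; apply/sgn_dom.
  by case: (@olt_irr (len y)); apply/sgn_dom; rewrite -xy; apply/sgn_dom.
case: x y xy E => [a p pP] [b q qP] /= /funext pq ab; subst.
by congr MkNo; apply: Prop_irrelevance.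
Qed.

Lemma No_first_diff (x y : No) (e : On) : x e <> y e -> exists c,
  [/\ forall b, olt b c -> x b = y b, x c <> y c & ~ olt e c].
Proof.
move=> xye; have [|c cP cmin] := @ex_olt_minimal [set c | x c <> y c].
  by exists e.
exists c; split=> // [b /cmin/contrapT//|ec].
exact: cmin ec xye.
Qed.

Lemma slt_total x y : [\/ slt x y, x = y | slt y x].
Proof.
have [H|/existsNP[e xye]] := pselect (forall b, x b = y b).
  exact/Or32/No_eq.
have [c [xy xyc _]] := No_first_diff xye.
have : sign_rank (x c) <> sign_rank (y c) by move=> /sign_rank_inj.
move=> /eqP; rewrite neq_ltn => /orP[] lt.
  by apply: Or31; apply/sltP; exists c.
by apply: Or33; apply/sltP; exists c => // b /xy.
Qed.

Lemma sle_or_lt x y : sle x y \/ slt y x.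
Proof. by have [||] := slt_total x y; [left; left|left; right|right]. Qed.

Lemma sle_lt_trans x y z : sle x y -> slt y z -> slt x z.
Proof. by move=> [xy|-> //]; apply: slt_trans. Qed.

Lemma slt_le_trans x y z : slt x y -> sle y z -> slt x z.
Proof. by move=> xy [|<- //]; apply: slt_trans. Qed.

Lemma sle_not_gt x y : sle x y -> ~ slt y x.
Proof. by move=> xy yx; apply: slt_irr (sle_lt_trans xy yx). Qed.

(** The last clause lets the bound inherit the side of a gap on which [x] and [y] lie. *)
Lemma slt_bound2 x y : exists z, [/\ sle x z, sle y z & z = x \/ z = y].
Proof.
have [xy|yx] := sle_or_lt x y; first by exists y; split=> //; right.
by exists x; split; [right|left|left].
Qed.

Lemma sgt_bound2 x y : exists z, [/\ sle z x, sle z y & z = x \/ z = y].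
Proof.
have [xy|yx] := sle_or_lt x y; first by exists x; split=> //; [right|left].
by exists y; split; [left|right|right].
Qed.

(** * Gaps and their neighbourhoods *)

Lemma gap_lowerN (k : gap) x : ~ lower k x <-> upper k x.
Proof.
split=> [Nl|ux lx].
  have : (lower k `|` upper k) x by rewrite gap_cover.
  by case.
have : (lower k `&` upper k) x by [].
by rewrite gap_disj.
Qed.

Lemma gap_upperN (k : gap) x : ~ upper k x <-> lower k x.
Proof.
by split=> [Nu|lx /gap_lowerN//]; apply: contrapT => /gap_lowerN.
Qed.

Lemma gap_side (k : gap) x : lower k x \/ upper k x.
Proof. by have [|/gap_lowerN] := pselect (lower k x); [left|right]. Qed.

Lemma lower_down (k : gap) x y : slt x y -> lower k y -> lower k x.
Proof.
move=> xy ly; apply/gap_upperN => ux.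
exact: slt_not_sym xy (gap_lt ly ux).
Qed.

Lemma upper_up (k : gap) x y : slt x y -> upper k x -> upper k y.
Proof.
move=> xy ux; apply/gap_lowerN => ly.
exact: slt_not_sym xy (gap_lt ly ux).
Qed.

Lemma ex_lower_gt2 (k : gap) x y : lower k x -> lower k y ->
  exists z, [/\ lower k z, slt x z & slt y z].
Proof.
move=> lx ly; have [m [xm ym mE]] := slt_bound2 x y.
have [|z lz mz] := @gap_nomax k m; first by case: mE => ->.
by exists z; split=> //; [exact: sle_lt_trans mz|exact: sle_lt_trans mz].
Qed.

Lemma ex_upper_lt2 (k : gap) x y : upper k x -> upper k y ->
  exists z, [/\ upper k z, slt z x & slt z y].
Proof.
move=> lx ly; have [m [xm ym mE]] := sgt_bound2 x y.
have [|z lz mz] := @gap_nomin k m; first by case: mE => ->.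
by exists z; split=> //; [exact: slt_le_trans xm|exact: slt_le_trans ym].
Qed.

(** [near_left k P]: [P] holds on [(a, k)] for some [a < k]; similarly for
    [near_right] and for the two-sided [near]. *)
Definition near_left (k : gap) (P : set No) : Prop :=
  exists2 a, lower k a & forall x, slt a x -> lower k x -> P x.

Definition near_right (k : gap) (P : set No) : Prop :=
  exists2 b, upper k b & forall x, upper k x -> slt x b -> P x.

Definition near (k : gap) (P : set No) : Prop :=
  exists a b, [/\ lower k a, upper k b &
    forall x, slt a x -> slt x b -> P x].

Lemma near_leftI k P Q :
  near_left k P -> near_left k Q -> near_left k (P `&` Q).
Proof.
move=> [a la aP] [b lb bQ]; have [z [lz az bz]] := ex_lower_gt2 la lb.
exists z => // x zx lx; split; [apply: aP|apply: bQ] => //.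
  exact: slt_trans zx.
exact: slt_trans zx.
Qed.

Lemma near_rightI k P Q :
  near_right k P -> near_right k Q -> near_right k (P `&` Q).
Proof.
move=> [a la aP] [b lb bQ]; have [z [lz az bz]] := ex_upper_lt2 la lb.
exists z => // x lx zx; split; [apply: aP|apply: bQ] => //.
  exact: slt_trans az.
exact: slt_trans bz.
Qed.

Lemma nearP k P : near k P <-> near_left k P /\ near_right k P.
Proof.
split=> [[a [b [la ub abP]]]|[[a la aP] [b ub bP]]].
  split; [exists a|exists b] => // x.
    by move=> ax lx; apply: abP => //; apply: gap_lt lx ub.
  by move=> ux xb; apply: abP => //; apply: gap_lt la ux.
exists a, b; split=> // x ax xb.
by have [lx|ux] := gap_side k x; [apply: aP|apply: bP].
Qed.

Lemma near_left_ex k P : near_left k P -> exists2 x, lower k x & P x.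
Proof.
by move=> [a la aP]; have [x lx ax] := gap_nomax la; exists x => //; apply: aP.
Qed.

Lemma near_right_ex k P : near_right k P -> exists2 x, upper k x & P x.
Proof.
by move=> [a la aP]; have [x lx ax] := gap_nomin la; exists x => //; apply: aP.
Qed.

Lemma near_left_mono k P Q : P `<=` Q -> near_left k P -> near_left k Q.
Proof. by move=> PQ [a la aP]; exists a => // x ax lx; apply/PQ/aP. Qed.

Lemma near_right_mono k P Q : P `<=` Q -> near_right k P -> near_right k Q.
Proof. by move=> PQ [a la aP]; exists a => // x ax lx; apply/PQ/aP. Qed.

Lemma near_mono k P Q : P `<=` Q -> near k P -> near k Q.
Proof.
move=> PQ /nearP[l r]; apply/nearP.
by split; [apply: near_left_mono l|apply: near_right_mono r].
Qed.

Lemma nearI k P Q : near k P -> near k Q -> near k (P `&` Q).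
Proof.
move=> /nearP[Pl Pr] /nearP[Ql Qr]; apply/nearP.
by split; [apply: near_leftI|apply: near_rightI].
Qed.

Lemma near_setT k (P : set No) : (forall x, P x) -> near k P.
Proof.
move=> PT; have [a la] := gap_lower_neq0 k; have [b ub] := gap_upper_neq0 k.
by exists a, b.
Qed.

(** * Infima and suprema that are not gaps *)

(** The part of the sup property that concerns a single class. *)
Definition regular (P : set No) : Prop := forall a b, slt a b ->
  let S := [set x | [/\ slt a x, slt x b & P x]] in
  (exists2 p, is_inf S p & ~ is_gap p) /\
  (exists2 p, is_sup S p & ~ is_gap p).

Lemma sup_property1P (h : No -> No) : sup_property1 h <->
  forall c, regular [set x | sle (h x) c] /\ regular [set x | sle c (h x)].
Proof.
split=> [H c|H a b c ab].
  by split=> a b ab; case: (H a b c ab).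
rewrite /=; by have [/(_ a b ab)[? ?] /(_ a b ab)[? ?]] := H c.
Qed.

(** If neither [D] has a maximum nor its complement a minimum, the two form a gap. Otherwise such an
    extremum bounds its own side, and it also bounds the other side when that side has no
    extremum. *)
Lemma dedekind_cut (D : set No) (d u : No) :
  (forall x y, slt x y -> D y -> D x) -> D d -> ~ D u ->
  (exists k, lower k = D) \/
  (exists e, is_sup D (Point e)) /\ (exists e, is_inf (~` D) (Point e)).
Proof.
move=> Ddown Dd Du.
have Dlt x y : D x -> ~ D y -> slt x y.
  move=> Dx Dy; have [//|E|/Ddown/(_ Dx)//] := slt_total x y.
  by rewrite E in Dx.
have [[e De emax]|nomax] := pselect (exists2 e, D e & forall x, D x -> sle x e).
  right; split.
    by exists e; split=> // q /(_ _ De).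
  have [[m Dm mmin]|nomin] :=
      pselect (exists2 m, ~ D m & forall x, ~ D x -> sle m x).
    by exists m; split=> // q /(_ _ Dm).
  exists e; split=> [x Dx|q qP]; first by left; apply: Dlt.
  have Nlt x : slt e x -> ~ D x by move=> ex /emax/sle_not_gt.
  case: q qP => [||x|k] qP //.
  - by have /= := qP _ Du.
  - have [//|ex] := sle_or_lt x e.
    by case: nomin; exists x => //; apply: Nlt.
  - apply/gap_lowerN => le; have [x lx ex] := gap_nomax le.
    by have /gap_lowerN := qP _ (Nlt _ ex).
have [[m Dm mmin]|nomin] :=
    pselect (exists2 m, ~ D m & forall x, ~ D x -> sle m x).
  right; split; last by exists m; split=> // q /(_ _ Dm).
  exists m; split=> [x Dx|q qP]; first by left; apply: Dlt.
  have Dgt x : slt x m -> D x.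
    by move=> xm; apply: contrapT => /mmin/sle_not_gt.
  case: q qP => [||x|k] qP //.
  - by have /= := qP _ Dd.
  - have [//|xm] := sle_or_lt m x.
    by case: nomax; exists x => //; apply: Dgt.
  - apply/gap_upperN => um; have [x ux xm] := gap_nomin um.
    by have /gap_upperN := qP _ (Dgt _ xm).
left; unshelve eexists (@MkGap D (~` D) _ _ _ _ _ _ _) => //.
- by rewrite setUCr.
- by rewrite setICr.
- by exists d.
- by exists u.
- move=> a Da; apply: contrapT => H; apply: nomax; exists a => // x Dx.
  by have [//|ax] := sle_or_lt x a; case: H; exists x.
- move=> a Da; apply: contrapT => H; apply: nomin; exists a => // x Dx.
  by have [//|ax] := sle_or_lt a x; case: H; exists x.
Qed.

Lemma point_not_gap x : ~ is_gap (Point x).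
Proof. by case. Qed.

Lemma cle_sle p x y : cle p (Point x) -> sle x y -> cle p (Point y).
Proof.
case: p => [||z|k] //= px [xy|<- //].
  by left; apply: sle_lt_trans xy.
exact: upper_up xy px.
Qed.

Lemma sle_cle p x y : sle x y -> cle (Point y) p -> cle (Point x) p.
Proof.
case: p => [||z|k] //= [xy|-> //] yp.
  by left; apply: slt_le_trans yp.
exact: lower_down xy yp.
Qed.

(** Were the infimum of [S] a gap, [P] would either hold throughout a neighbourhood of it, putting
    points of [S] below the infimum, or fail throughout one, leaving no points of [S] just above it.
    The supremum is symmetric. *)
Lemma regular_near (P : set No) :
  (forall k, near k P \/ near k (~` P)) -> regular P.
Proof.
move=> Pk a b ab S.
have [[s Ss]|S0] := pselect (exists s, S s); last first.
  (* The empty class has infimum plus infinity and supremum minus infinity. *)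
  split; [exists PInfty|exists MInfty]; do ?by case.
    by split=> [x Sx|[]] //; case: S0; exists x.
  by split=> [x Sx|[]] //; case: S0; exists x.
have nearS k : lower k a -> upper k b -> near k P -> near k S.
  move=> la ub nP; have nab : near k [set x | slt a x /\ slt x b].
    by exists a, b; split=> //.
  by apply: near_mono (nearI nab nP) => x [[]].
split.
(* The complement of this class of strict lower bounds is the upward closure of [S], which has the
   same infimum as [S]. *)
- pose D := [set y | forall x, S x -> slt y x].
  have SD x : S x -> ~ D x by move=> Sx /(_ x Sx)/slt_irr.
  have ND x : ~ D x -> exists2 y, S y & sle y x.
    move=> /existsNP[y /not_implyP[Sy xy]]; exists y => //.
    by have [|/xy] := sle_or_lt y x.
  have Da : D a by move=> x [].
  have Db : ~ D b.
    by move=> /(_ _ Ss); case: Ss => _ sb _; apply: slt_not_sym.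
  have [|[k kD]|[_ [e [eD emax]]]] := @dedekind_cut D a b _ Da Db.
  + by move=> x y xy Dy z /Dy; apply: slt_trans.
  + have [nP|/nearP[_ [u uu NP]]] := Pk k.
      have /nearP[/near_left_ex[x + Sx] _] : near k S.
        by apply: nearS => //; [rewrite kD|apply/gap_lowerN; rewrite kD].
      by rewrite kD => /(SD x Sx).
    have [v uv vu] := gap_nomin uu.
    have [|y Sy yv] := ND v; first by rewrite -kD; apply/gap_lowerN.
    case: (NP y); last by case: Sy.
      by apply/gap_lowerN; rewrite kD; apply: SD.
    exact: sle_lt_trans vu.
  exists (Point e); last exact: point_not_gap.
  split=> [x Sx|q qS]; first exact/eD/SD.
  apply: emax => x /ND[y Sy yx].
  exact: cle_sle (qS _ Sy) yx.
(* Dually, the downward closure of [S] has the same supremum as [S]. *)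
- pose D := [set y | exists2 x, S x & sle y x].
  have SD x : S x -> D x by move=> Sx; exists x => //; right.
  have Da : D a by exists s => //; left; case: Ss.
  have Db : ~ D b by move=> [x [_ xb _] /sle_not_gt].
  have [|[k kD]|[[e [eD emin]] _]] := @dedekind_cut D a b _ Da Db.
  + by move=> x y xy [z Sz yz]; exists z => //; left; apply: slt_le_trans yz.
  + have [nP|/nearP[[u uu NP] _]] := Pk k.
      have /nearP[_ /near_right_ex[x + Sx]] : near k S.
        by apply: nearS => //; [rewrite kD|apply/gap_lowerN; rewrite kD].
      by move=> /gap_lowerN[]; rewrite kD; apply: SD.
    have [v] := gap_nomax uu; rewrite {1}kD => -[y Sy vy] uv.
    case: (NP y); last by case: Sy.
      exact: slt_le_trans vy.
    by rewrite kD; apply: SD.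
  exists (Point e); last exact: point_not_gap.
  split=> [x Sx|q qS]; first exact/eD/SD.
  apply: emin => x [y Sy xy].
  exact: sle_cle xy (qS _ Sy).
Qed.

(** If [P] accumulates at [k] but fails just to the left of it, then [k] itself is the infimum of
    [P] on a suitable interval, which regularity forbids; on the right, [k] would be a supremum. *)
Lemma regular_two_sided (P : set No) (k : gap) : regular P ->
  ~ near k (~` P) -> ~ near_left k (~` P) /\ ~ near_right k (~` P).
Proof.
move=> regP meetP.
have meet x y : lower k x -> upper k y ->
    exists z, [/\ slt x z, slt z y & P z].
  move=> lx uy; apply: contrapT => H; apply: meetP.
  by exists x, y; split=> // z xz zy Pz; apply: H; exists z.
split=> [[a la aP]|[b ub bP]].
- have [b ub] := gap_upper_neq0 k.
  have [[p [pS pmax] pNgap] _] := regP a b (gap_lt la ub).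
  have SU x : [/\ slt a x, slt x b & P x] -> upper k x.
    by move=> [ax _ Px]; apply/gap_lowerN => /(aP x ax).
  have meetS y : upper k y ->
      exists2 x, [/\ slt a x, slt x b & P x] & slt x y.
    move=> uy; have [m [um mb my]] := ex_upper_lt2 ub uy.
    have [z [az zm Pz]] := meet a m la um.
    exists z; last exact: slt_trans my.
    by split=> //; apply: slt_trans mb.
  have /= := pmax (Gap k) (fun x Sx => SU x Sx).
  case: p pS pNgap {pmax} => [||e|k'] pS pNgap //.
  + by have [x /pS] := meetS b ub.
  + by move=> /meetS[x /pS/sle_not_gt].
  + by case: pNgap; exists k'.
- have [a la] := gap_lower_neq0 k.
  have [_ [p [pS pmin] pNgap]] := regP a b (gap_lt la ub).
  have SL x : [/\ slt a x, slt x b & P x] -> lower k x.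
    by move=> [_ xb Px]; apply/gap_upperN => /(bP x); apply.
  have meetS y : lower k y ->
      exists2 x, [/\ slt a x, slt x b & P x] & slt y x.
    move=> ly; have [m [um mb my]] := ex_lower_gt2 la ly.
    have [z [az zm Pz]] := meet m b um ub.
    exists z; last exact: slt_trans az.
    by split=> //; apply: slt_trans az.
  have /= := pmin (Gap k) (fun x Sx => SL x Sx).
  case: p pS pNgap {pmin} => [||e|k'] pS pNgap //.
  + by have [x /pS] := meetS a la.
  + by move=> /meetS[x /pS/sle_not_gt].
  + by case: pNgap; exists k'.
Qed.

(** * The sign sequence of a gap *)

Lemma restrict_signs_dom (s : On -> sign) (a b : On) :
  (if `[< olt b a >] then Some (s b) else None) <> None <-> olt b a.
Proof. by case: asboolP. Qed.

Definition restrict_signs (s : On -> sign) (a : On) : No :=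
  MkNo (restrict_signs_dom s a).

(** Makes total the partial sequence supplied by well-founded recursion; the default [Minus] lies
    outside the prefix of length [a]. *)
Definition extend_signs (a : On) (s : forall b, olt b a -> sign) (b : On) :=
  if pselect (olt b a) is left ba then s b ba else Minus.

(** A binary search for [k]: the next sign points from the prefix built so far towards the gap. *)
Definition gap_sign (k : gap) : On -> sign :=
  Fix olt_wf (fun=> sign) (fun a s =>
    if `[< lower k (restrict_signs (extend_signs s) a) >] then Plus else Minus).

(** The initial segment of length [a] of the sign sequence, of length [On],
    of the gap [k]. *)
Definition gap_prefix (k : gap) (a : On) : No := restrict_signs (gap_sign k) a.

Lemma gap_prefix_lt k a b : olt b a -> gap_prefix k a b = Some (gap_sign k b).
Proof. by move=> /asboolP /= ->. Qed.

Lemma gap_prefix_ge k a b : ~ olt b a -> gap_prefix k a b = None.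
Proof. by move=> /asboolPn /= /negbTE ->. Qed.

Lemma gap_signE k a :
  gap_sign k a = if `[< lower k (gap_prefix k a) >] then Plus else Minus.
Proof.
rewrite {1}/gap_sign Fix_eq => [|x s t st]; last first.
  by have -> : s = t by apply: functional_extensionality_dep => b;
    apply: functional_extensionality_dep => ba.
congr (if `[< lower k _ >] then _ else _); apply: No_eq => b /=.
by case: asboolP => // ba; rewrite /extend_signs; case: pselect.
Qed.

Lemma lower_prefixE k a : lower k (gap_prefix k a) <-> gap_sign k a = Plus.
Proof. by rewrite gap_signE; case: asboolP. Qed.

Lemma simpler_gap_prefix k a y : simpler y (gap_prefix k a) ->
  olt (len y) a /\ y = gap_prefix k (len y).
Proof.
move=> [ya yE]; split=> //; apply: No_eq => b.
have [by_|byN] := pselect (olt b (len y)).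
  by rewrite yE // (gap_prefix_lt k by_) gap_prefix_lt //; apply: olt_trans ya.
rewrite gap_prefix_ge //; apply: contrapT => /sgn_dom//.
Qed.

Lemma gap_prefix_simpler k a b : olt b a ->
  forall c, olt c b -> gap_prefix k b c = gap_prefix k a c.
Proof.
by move=> ba c cb; rewrite (gap_prefix_lt k cb) gap_prefix_lt //; apply: olt_trans ba.
Qed.

(** The prefixes first differ at [b], where the shorter one is undefined and the longer one carries
    the sign chosen according to the side of the shorter one. *)
Lemma lt_prefix_lower k a b : olt b a ->
  slt (gap_prefix k b) (gap_prefix k a) <-> lower k (gap_prefix k b).
Proof.
move=> ba; have Eb := gap_prefix_lt k ba.
have Nb : gap_prefix k b b = None by apply/gap_prefix_ge/olt_irr.
split=> [H|lb].
  apply/lower_prefixE; case E : (gap_sign k b) => //.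
  case: (slt_not_sym H); apply/sltP; exists b; last by rewrite Nb Eb E.
  by move=> c cb; rewrite (gap_prefix_simpler k ba).
apply/sltP; exists b; first exact: gap_prefix_simpler.
by rewrite Nb Eb (lower_prefixE k b).1.
Qed.

Lemma Lopt_gap_prefix k a y : Lopt (gap_prefix k a) y ->
  lower k y /\ exists2 b, olt b a & y = gap_prefix k b.
Proof.
move=> [lt /simpler_gap_prefix[ya yE]]; split; last by exists (len y).
by rewrite yE; apply/(lt_prefix_lower k ya); rewrite -yE.
Qed.

Lemma Ropt_gap_prefix k a y : Ropt (gap_prefix k a) y ->
  upper k y /\ exists2 b, olt b a & y = gap_prefix k b.
Proof.
move=> [lt /simpler_gap_prefix[ya yE]]; split; last by exists (len y).
apply/gap_lowerN; rewrite yE => /(lt_prefix_lower k ya); rewrite -yE.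
exact: slt_not_sym.
Qed.

(** At the first difference [c], the sign of [k] decides both comparisons: if it is plus, [x] is at
    most the prefix of length [c], which lies below [k]; if it is minus, [x] is at least that
    prefix, which lies above [k]. *)
Lemma gap_prefix_side k a x : olt (len x) a ->
  (lower k x <-> slt x (gap_prefix k a)) /\ gap_prefix k a <> x.
Proof.
move=> xa.
have xN : x (len x) = None by apply: contrapT => /sgn_dom/olt_irr.
(* At [len x] the prefix is defined and [x] is not, so they differ no later than there, hence below
   [a]. *)
have [c [eqc Nc cx]] : exists c,
    [/\ forall b, olt b c -> x b = gap_prefix k a b, x c <> gap_prefix k a c
      & ~ olt (len x) c].
  by apply: No_first_diff; rewrite xN gap_prefix_lt.
have ca : olt c a by case: (olt_not_sym cx) => [<- //|/olt_trans]; apply.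
have Ea := gap_prefix_lt k ca.
split; last by move=> E; apply: Nc; rewrite -E.
have Ecx b : olt b c -> gap_prefix k c b = x b.
  by move=> bc; rewrite eqc // (gap_prefix_simpler k ca).
have Ncc : gap_prefix k c c = None by apply/gap_prefix_ge/olt_irr.
have xc : x c = None -> x = gap_prefix k c.
  move=> xcN; apply: No_eq => b.
  have [bc|bc] := pselect (olt b c); first by rewrite Ecx.
  rewrite gap_prefix_ge //; apply: contrapT => /sgn_dom bx.
  have : olt c (len x) by case: (olt_not_sym bc) => [<- //|/olt_trans]; apply.
  by move=> /sgn_dom.
have sideE := lower_prefixE k c.
case E : (gap_sign k c) sideE => sideE.
  have uc : ~ lower k (gap_prefix k c) by move=> /sideE.
  split=> [lx|lt]; last first.
    case: (slt_not_sym lt); apply/sltP; exists c => [b /eqc//|].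
    rewrite Ea E /=; move: Nc; rewrite Ea E.
    by case: (x c) => [[]|].
  case: uc; case Ex : (x c) => [[]|].
  - by case: Nc; rewrite Ex Ea E.
  - apply: lower_down lx; apply/sltP; exists c => //.
    by rewrite Ncc Ex.
  - by rewrite -(xc Ex).
have lc : lower k (gap_prefix k c) by apply/sideE.
have lt : slt x (gap_prefix k a).
  apply/sltP; exists c => //; rewrite Ea E; move: Nc; rewrite Ea E.
  by case: (x c) => [[]|].
split=> // _; case Ex : (x c) => [[]|].
- apply: lower_down lc; apply/sltP; exists c => [b /Ecx//|].
  by rewrite Ncc Ex.
- by case: Nc; rewrite Ex Ea E.
- by rewrite (xc Ex).
Qed.

Lemma lower_lt_prefix k a x : olt (len x) a -> lower k x ->
  slt x (gap_prefix k a).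
Proof. by move=> /(gap_prefix_side k)[[]]. Qed.

Lemma prefix_lt_upper k a x : olt (len x) a -> upper k x ->
  slt (gap_prefix k a) x.
Proof.
move=> /(gap_prefix_side k)[lE ne] /gap_lowerN ux.
by have [//|/ne//|/lE] := slt_total (gap_prefix k a) x.
Qed.

(** Prefixes longer than both endpoints of a neighbourhood of [k] lie between them. *)
Lemma near_gap_prefix k P : near k P ->
  exists a0, forall a, olt a0 a -> P (gap_prefix k a).
Proof.
move=> [x [y [lx uy xyP]]]; have [a0 xa ya] := olt_bound2 (len x) (len y).
exists a0 => a aa; apply: xyP.
  by apply: lower_lt_prefix => //; apply: olt_trans aa.
by apply: prefix_lt_upper => //; apply: olt_trans aa.
Qed.

(** * Values crossed at a gap *)

Definition crossing (k : gap) (h : No -> No) (c : No) : Prop :=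
  near_left k [set x | slt (h x) c] /\ near_right k [set x | slt c (h x)] \/
  near_left k [set x | slt c (h x)] /\ near_right k [set x | slt (h x) c].

Lemma tame1_near (h : No -> No) k c : tame1 h -> ~ crossing k h c ->
  [\/ forall x, h x = c, near k [set x | slt c (h x)] |
      near k [set x | slt (h x) c]].
Proof.
move=> [[e he]|tm] Ncr.
  have [ec|<-|ce] := slt_total e c.
  - by apply/Or33/near_setT => x /=; rewrite he.
  - exact: Or31.
  - by apply/Or32/near_setT => x /=; rewrite he.
have [a [b [la ub lft rgt]]] := tm k c.
case: lft rgt => lft [] rgt.
- by apply/Or32/nearP; split; [exists a|exists b].
- by case: Ncr; right; split; [exists a|exists b].
- by case: Ncr; left; split; [exists a|exists b].
- by apply/Or33/nearP; split; [exists a|exists b].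
Qed.

(** Without crossings, each class cut out by a value, or its complement, contains a neighbourhood of
    every gap, so [regular_near] applies. *)
Lemma tame1_sup_property (h : No -> No) : tame1 h ->
  (forall k c, ~ crossing k h c) -> sup_property1 h.
Proof.
move=> tm Ncr; apply/sup_property1P => c.
split; apply: regular_near => k.
  have [H|H|H] := tame1_near tm (Ncr k c).
  - by left; apply: near_setT => x; rewrite /= H; right.
  - by right; apply: near_mono H => x cx /sle_not_gt.
  - by left; apply: near_mono H => x; left.
have [H|H|H] := tame1_near tm (Ncr k c).
- by left; apply: near_setT => x; rewrite /= H; right.
- by left; apply: near_mono H => x; left.
- by right; apply: near_mono H => x cx /sle_not_gt.
Qed.

Lemma crossing_ex k h c : crossing k h c ->
  ~ near k [set x | sle (h x) c] /\ ~ near k [set x | sle c (h x)].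
Proof.
move=> cr; split=> /nearP[L R]; case: cr => -[l r].
- by have [x _ [/= /sle_not_gt]] := near_right_ex (near_rightI R r).
- by have [x _ [/= /sle_not_gt]] := near_left_ex (near_leftI L l).
- by have [x _ [/= /sle_not_gt]] := near_left_ex (near_leftI L l).
- by have [x _ [/= /sle_not_gt]] := near_right_ex (near_rightI R r).
Qed.

(** If [h] were constantly [d], or below [d] near [k], it would stay below [c] near [k] and could
    not cross [c]. *)
Lemma crossing_lt k h c d : tame1 h -> crossing k h c -> slt d c ->
  ~ crossing k h d -> near k [set x | slt d (h x)].
Proof.
move=> tm /crossing_ex[crP _] dc /(tame1_near tm)[H|//|H]; case: crP.
  by apply: near_setT => x; left; rewrite H.
by apply: near_mono H => x xd; left; apply: slt_trans dc.
Qed.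

Lemma crossing_gt k h c d : tame1 h -> crossing k h c -> slt c d ->
  ~ crossing k h d -> near k [set x | slt (h x) d].
Proof.
move=> tm /crossing_ex[_ crP] dc /(tame1_near tm)[H|H|//]; case: crP.
  by apply: near_setT => x; left; rewrite H.
by apply: near_mono H => x; left; apply: slt_trans dc _.
Qed.

(** * Cuts and options along the prefixes of a gap *)

(** Each [d] has its own threshold length, and a set of thresholds is bounded. *)
Lemma near_prefix_family k (S : set No) (Q : No -> set No) : small S ->
  (forall d, S d -> near k (Q d)) ->
  exists a0, forall a, olt a0 a -> forall d, S d -> Q d (gap_prefix k a).
Proof.
move=> smS SQ.
have [h hP] : {h : No -> On & forall d, S d ->
    forall a, olt (h d) a -> Q d (gap_prefix k a)}.
  apply: (@choice _ _ (fun d a0 => S d -> forall a, olt a0 a -> _)) => d.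
  have [/SQ/near_gap_prefix[a0 a0P]|NS] := pselect (S d); first by exists a0.
  by exists (len d).
have [a0 a0P] := small_bounded (small_image h smS).
exists a0 => a aa d Sd; apply: hP => //; apply: olt_trans aa.
by apply: a0P; exists d.
Qed.

Lemma small_simpler x : small [set y | simpler y x].
Proof.
pose s b := odflt Minus (x b).
apply: small_sub (small_image (restrict_signs s) (olt_small (len x))).
move=> y [yx yE]; exists (len y) => //; apply: No_eq => b /=.
case: asboolP => [by_|byN]; last by symmetry; apply: contrapT => /sgn_dom.
rewrite yE // /s; have /sgn_dom := olt_trans by_ yx.
by case: (x b).
Qed.

(** If [c] lay in the cut, [v] would be strictly simpler than [c], hence one of its canonical
    options, and so would be less than itself. *)
Lemma simplest_between (L R : set No) (c v : No) : is_cut L R v -> v <> c ->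
  (forall d, Lopt c d -> slt d v) -> (forall d, Ropt c d -> slt v d) ->
  (exists2 l, L l & sle c l) \/ (exists2 r, R r & sle r c).
Proof.
move=> [_ _ _ [_ vmin]] vc vL vR; apply: contrapT => /not_orP[NL NR].
have [|vs|//] := vmin c.
  split=> [l Ll|r Rr].
    by have [cl|//] := sle_or_lt c l; case: NL; exists l.
  by have [rc|//] := sle_or_lt r c; case: NR; exists r.
have [lt|//|lt] := slt_total v c.
  exact: slt_irr (vL v _).
exact: slt_irr (vR v _).
Qed.

(** Either [x] is the first variable of [h] and all the others are parameters, or [g] is constant in
    [x] and crosses nothing. *)
Lemma option_of_sup_property (A : function_family) (g : option5) :
  (forall (n : nat) (h : n.+1.-tuple No -> No), A n h -> sup_property h) ->
  option_of A g ->
  forall y z u v, sup_property1 (fun x => g x y z u v).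
Proof.
move=> Asup [n [h [s [Ah inj_s s0 gE]]]] y z u v.
have [s00|s0N] := eqVneq (s ord0) ord0.
  (* The first [y] fills the slot of [x], which the variables after the first never select. *)
  pose d := [tuple tnth [tuple y; y; z; u; v] (s (lift ord0 i)) | i < n].
  have -> : (fun x => g x y z u v) = (fun x => h [tuple of x :: d]).
    apply/funext => x; rewrite gE; congr h; apply: eq_from_tnth => i.
    rewrite tnth_mktuple; have [j ->|->] := unliftP ord0 i; last first.
      by rewrite s00.
    rewrite tnthS tnth_mktuple.
    have : s (lift ord0 j) != ord0 by apply/eqP => /s0.
    by case: (s _) => -[|m] // lt_m _; rewrite !(tnth_nth x).
  exact: Asup.
have gcst x : g x y z u v = g y y z u v.
  rewrite !gE; congr h; apply: eq_from_tnth => i; rewrite !tnth_mktuple.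
  have : s i != ord0.
    by apply/eqP => si; move: s0N; rewrite -(s0 _ si) si eqxx.
  by case: (s _) => -[|m] // lt_m _; rewrite !(tnth_nth x).
apply: tame1_sup_property; first by left; exists (g y y z u v).
move=> k c /crossing_ex[N1 N2].
have [le|lt] := sle_or_lt (g y y z u v) c.
  by apply: N1; apply: near_setT => x /=; rewrite gcst.
by apply: N2; apply: near_setT => x /=; rewrite gcst; left.
Qed.

(** * Excluding crossings by Fodor's lemma *)

Lemma recursive_no_crossing (f : No -> No) (L R : set option5) :
  tame1 f -> uniform_def f L R ->
  (forall g, (L `|` R) g ->
     forall y z u v, sup_property1 (fun x => g x y z u v)) ->
  forall k c, ~ crossing k f c.
Proof.
move=> tm [[smL smR frec] uni _] gsup k c.
(* Induction on the length of [c]: no value simpler than [c] is crossed at [k]. *)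
move eq_l : (len c) => l; elim: (olt_wf l) c eq_l => {}l _ IH c cl cr.
have {l cl}IH d : simpler d c -> ~ crossing k f d.
  by move=> [dc _]; apply: IH erefl; rewrite -cl.
(* The left options of [c] form a set, and [f] exceeds each of them near [k] since none is
   crossed. *)
have [aL aLP] : exists a0, forall a, olt a0 a ->
    forall d, Lopt c d -> slt d (f (gap_prefix k a)).
  apply: (@near_prefix_family k _ (fun d => [set x | slt d (f x)])).
    by apply: small_sub (small_simpler c) => d [].
  by move=> d [dc /IH]; apply: crossing_lt cr dc.
have [aR aRP] : exists a0, forall a, olt a0 a ->
    forall d, Ropt c d -> slt (f (gap_prefix k a)) d.
  apply: (@near_prefix_family k _ (fun d => [set x | slt (f x) d])).
    by apply: small_sub (small_simpler c) => d [].
  by move=> d [dc /IH]; apply: crossing_gt cr dc.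
have [aN aNP] : exists a0, forall a, olt a0 a -> f (gap_prefix k a) <> c.
  apply: (near_gap_prefix (P := [set x | f x <> c])); apply/nearP.
  have ltN : [set x | slt (f x) c] `<=` [set x | f x <> c].
    by move=> x /= + E; rewrite E => /slt_irr.
  have gtN : [set x | slt c (f x)] `<=` [set x | f x <> c].
    by move=> x /= + E; rewrite E => /slt_irr.
  by case: cr => -[l r]; split;
    [exact: near_left_mono l|exact: near_right_mono r
    |exact: near_left_mono l|exact: near_right_mono r].
have [a1 aLa1 aRa1] := olt_bound2 aL aR.
have [a0 a1a0 aNa0] := olt_bound2 a1 aN.
(* Fixed dummies for arguments on which an option does not depend; their sides make [(y0, z0)] a
   neighbourhood of [k]. *)
have [y0 ly0] := gap_lower_neq0 k; have [z0 uz0] := gap_upper_neq0 k.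
(* The boolean records whether the offending option is a left or a right one. *)
pose C a := [set t : bool * (option5 * (No * No)) |
  let: (s, (g, (y, z))) := t in
  let w := g (gap_prefix k a) y z (f y) (f z) in
  [/\ lower k y, upper k z &
      if s then L g /\ sle c w else R g /\ sle w c]].
pose Y w a := [set w] `|` gap_prefix k @` [set b | olt b a].
(* The candidates at stage [a] form a set: [y] and [z] are dummies or prefixes of length below
   [a]. *)
pose K a := [set: bool] `*` ((L `|` R) `*` (Y y0 a `*` Y z0 a)).
have smY w a : small (Y w a).
  exact: small_setU (small_set1 w) (small_image _ (olt_small a)).
have KC a : olt a0 a -> exists2 t, K a t & C a t.
  move=> a0a; have a1a := olt_trans a1a0 a0a.
  have := simplest_between (frec (gap_prefix k a))
    (aNP _ (olt_trans aNa0 a0a)) (aLP _ (olt_trans aLa1 a1a))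
    (aRP _ (olt_trans aRa1 a1a)).
  have optE G w : option_values G f (gap_prefix k a)
      (Lopt (gap_prefix k a)) (Ropt (gap_prefix k a)) w ->
      exists g y z, [/\ G g, lower k y /\ Y y0 a y, upper k z /\ Y z0 a z
        & w = g (gap_prefix k a) y z (f y) (f z)].
    move=> [g [y [z [Gg yP zP ->]]]].
    have [y' [y'P Ey]] : exists y', (lower k y' /\ Y y0 a y') /\
        forall z v, g (gap_prefix k a) y z (f y) v =
                    g (gap_prefix k a) y' z (f y') v.
      case: yP => [/Lopt_gap_prefix[ly [b ba yE]]|[gy gu]].
        by exists y; do !split=> //; right; exists b.
      exists y0; do !split=> //; first by left.
      by move=> z' v; rewrite (gy _ y y0) (gu _ _ _ (f y) (f y0)).
    have [z' [z'P Ez]] : exists z', (upper k z' /\ Y z0 a z') /\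
        forall y u, g (gap_prefix k a) y z u (f z) =
                    g (gap_prefix k a) y z' u (f z').
      case: zP => [/Ropt_gap_prefix[lz [b ba zE]]|[gz gv]].
        by exists z; do !split=> //; right; exists b.
      exists z0; do !split=> //; first by left.
      by move=> y'' u; rewrite (gz _ _ z z0) (gv _ _ _ _ (f z) (f z0)).
    by exists g, y', z'; split=> //; rewrite Ey Ez.
  case=> -[_ /optE[g [y [z [Gg [ly Yy] [uz Yz] ->]]]] cw].
    by exists (true, (g, (y, z))); do !split=> //; left.
  by exists (false, (g, (y, z))); do !split=> //; right.
have [||[s [g [y z]]] gyzC] := pressing_down _ _ KC.
- move=> a; do 2 ?apply: small_setX; first exact: small_setT.
    exact: small_setU.
  exact: small_setX.
(* At a limit stage the lengths of [y] and [z] are reached at stages [n] and [m], hence both at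
   [n + m]. *)
- move=> d a [s [g [y z]]] dS dP [_ [/= gLR [/= Yy Yz]]].
  have Ymono w n m : Y w (d n) `<=` Y w (d (n + m)).
    elim: m => [|m IHm]; first by rewrite addn0.
    move=> x /IHm[->|[b bd <-]]; first by left.
    by right; exists b => //; rewrite addnS; apply: olt_trans (dS _).
  have Ycont w x : Y w a x -> exists n, Y w (d n) x.
    move=> [->|[b /dP[n bn] <-]]; first by exists 0; left.
    by exists n; right; exists b.
  have [n Yn] := Ycont _ _ Yy; have [m Ym] := Ycont _ _ Yz.
  exists (n + m); do !split=> //=; first exact: Ymono.
  by rewrite addnC; apply: Ymono.
have [b _ [ly uz gLR]] := gyzC a0.
have [notlt notgt] := crossing_ex cr.
have nearyz Q : (forall x, slt y x -> slt x z -> Q x) -> near k Q.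
  by move=> H; exists y, z.
pose h x := g x y z (f y) (f z).
(* Arbitrarily long prefixes lie in the class, so it meets every neighbourhood of [k]. *)
have meet (P : set No) : (forall a, C a (s, (g, (y, z))) -> P (gap_prefix k a)) ->
    ~ near k (~` P).
  move=> CP /near_gap_prefix[a aP]; have [e ae /CP] := gyzC a.
  exact: aP.
case: s gLR gyzC meet => -[Gg _] gyzC meet.
(* Uniformity keeps the left option [h] below [f] on all of [(y, z)]. On the side of [k] where [f]
   is below [c], so is [h], and the class where [h] is at least [c] misses that side. Right options
   are treated dually. *)
- have sub : near k [set x | slt (h x) (f x)].
    by apply: nearyz => x yx xz; apply: (uni x y z yx xz).1.
  have [||N1 N2] := @regular_two_sided [set x | sle c (h x)] k.
  + by have /sup_property1P/(_ c)[] := gsup g (or_introl Gg) y z (f y) (f z).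
  + by apply: meet => a [_ _ []].
  have {}/nearP[subl subr] := sub.
  case: cr => -[l r].
    apply: N1; apply: near_left_mono (near_leftI subl l) => x [/= hf fc].
    by move=> /sle_not_gt; apply; apply: slt_trans fc.
  apply: N2; apply: near_right_mono (near_rightI subr r) => x [/= hf fc].
  by move=> /sle_not_gt; apply; apply: slt_trans fc.
- have sub : near k [set x | slt (f x) (h x)].
    by apply: nearyz => x yx xz; apply: (uni x y z yx xz).2.
  have [||N1 N2] := @regular_two_sided [set x | sle (h x) c] k.
  + by have /sup_property1P/(_ c)[] := gsup g (or_intror Gg) y z (f y) (f z).
  + by apply: meet => a [_ _ []].
  have {}/nearP[subl subr] := sub.
  case: cr => -[l r].
    apply: N2; apply: near_right_mono (near_rightI subr r) => x [/= hf fc].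
    by move=> /sle_not_gt; apply; apply: slt_trans hf.
  apply: N1; apply: near_left_mono (near_leftI subl l) => x [/= hf fc].
  by move=> /sle_not_gt; apply; apply: slt_trans hf.
Qed.

Theorem mainTheorem1 (A : function_family) (f : No -> No)
  (A_tame : forall (n : nat) (g : n.+1.-tuple No -> No), A n g -> tame g)
  (A_sup : forall (n : nat) (g : n.+1.-tuple No -> No), A n g -> sup_property g)
  (f_rec : uniformly_recursive_over A f)
  (f_tame : tame1 f) :
  sup_property1 f.
Proof.
have [L [R [LA RA fdef]]] := f_rec.
apply: tame1_sup_property => //; apply: recursive_no_crossing fdef _ => //.
move=> g [/LA|/RA]; exact: option_of_sup_property.
Qed.
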